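(* Let $N_f>1$ and let an admissible scheme transformation have $x$-space sector kernels $K_{\Sigma\Sigma}$, $K_{\Sigma g}$, $K_{g\Sigma}$, $K_{gg}$ for the singlet-gluon block and $K^+_{\rm ns}$, $K^-_{\rm ns}$, $K_{\Sigma_-}$ for the $C$-even non-singlet, $C$-odd non-singlet and $C$-odd singlet scalars, each a function plus a multiple of $\delta(1-x)$. The transformation maps every collection of nonnegative densities $(q_i,\bar q_i,g)_{i=1,\dots,N_f}$ into nonnegative densities if and only if $$K_{\Sigma g}\geqslant0,\qquad K_{g\Sigma}\geqslant0,\qquad K_{gg}\geqslant0,\qquad K_{\Sigma\Sigma}-K^+_{\rm ns}\geqslant\big|K_{\Sigma_-}-K^-_{\rm ns}\big|,$$ together with, for both choices of the sign $\pm$, $$N_f\big(K^+_{\rm ns}\pm K^-_{\rm ns}\big)+\big(K_{\Sigma\Sigma}-K^+_{\rm ns}\big)\pm\big(K_{\Sigma_-}-K^-_{\rm ns}\big)\geqslant0,$$ at every $x$.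
   Context: **Densities and convolution.** Densities $q_i,\bar q_i$ ($i=1,\dots,N_f$) and $g$ are functions of $x\in(0,1)$. The scale $\mu$ is held fixed. The Mellin convolution is $(K\otimes f)(x)=\int_x^1\frac{d\xi}{\xi}K(\xi)f(x/\xi)$, with $\delta(1-x)$ acting as the identity. A kernel is a real function on $(0,1)$ plus a real multiple of $\delta(1-x)$, with Mellin transform $\int_0^1dx\,x^{z-1}K(x)$ convergent in some right half-plane. An inequality between kernels ''at every $x$'' means the inequality for the function parts (functions being identified up to null sets) and for the coefficients of $\delta(1-x)$. **Sectors.** $\Sigma_\pm=\sum_i(q_i\pm\bar q_i)$ and $q_i^\pm=q_i\pm\bar q_i$. A transformation that respects charge conjugation and flavor permutations (in particular every admissible one) acts as $$\Sigma_+\mapsto K_{\Sigma\Sigma}\otimes\Sigma_++K_{\Sigma g}\otimes g,\qquad g\mapsto K_{g\Sigma}\otimes\Sigma_++K_{gg}\otimes g,\qquad \Sigma_-\mapsto K_{\Sigma_-}\otimes\Sigma_-,$$ $$q_i^\pm-\tfrac1{N_f}\Sigma_\pm\ \mapsto\ K^\pm_{\rm ns}\otimes\big(q_i^\pm-\tfrac1{N_f}\Sigma_\pm\big).$$ **Admissible transformation.** Let $\mathcal K(z;\mu)$ be the Mellin transform (in $x$, at scale $\mu$) of the full matrix kernel on the $(2N_f+1)$-dimensional flavor space, and let $\gamma(z;\mu)$ be the reference DGLAP kernel, $\frac{d}{d\ln\mu^2}\overline f=\gamma\overline f$, which commutes with charge conjugation $C$ ($q_i\leftrightarrow\bar q_i$)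 and flavor permutations. $\mathcal K$ is a scheme transformation if it is invertible, differentiable in $\mu$, analytic in $z$ with $\mathcal K(\bar z;\mu)=\overline{\mathcal K(z;\mu)}$, acts by $\overline f^{(s)}=\mathcal K\overline f$ and $\gamma^{(s)}=\mathcal K\gamma\mathcal K^{-1}+\big(\tfrac{d\mathcal K}{d\ln\mu^2}\big)\mathcal K^{-1}$, and is $1+O(a_s)$ (a power series in the coupling $a_s(\mu)$) as $\mu\to\infty$. It is admissible if $\gamma^{(s)}$ again commutes with $C$ and all flavor permutations at every $z$, and the transformed densities obey the sum rules $\sum_j\int_0^1x f_j\,dx=1$ (sum over all partons) and $\int_0^1(q_i-\bar q_i)\,dx=n_{q_i}$ whenever the input densities do. *)

(* Defs.v *)
From HB Require Import structures.
From mathcomp Require Import all_boot all_order all_algebra all_fingroup.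
From mathcomp Require Import complex.
From mathcomp Require Import all_classical all_reals all_analysis.

Set Implicit Arguments.
Unset Strict Implicit.
Unset Printing Implicit Defensive.

Import Order.TTheory GRing.Theory Num.Theory.
Import numFieldNormedType.Exports.

Local Open Scope classical_set_scope.
Local Open Scope ring_scope.

Section Kernels.
Variable R : realType.
Let leb := @lebesgue_measure R.

Definition I01 : set R := `]0%R, 1%R[.

(* The distribution kfun(x) + kdelta * delta(1 - x) on (0, 1); the values of
   kfun outside (0, 1) are irrelevant. *)
Record xkernel := XKernel { kfun : R -> R ; kdelta : R }.

(* Convergence, as a Lebesgue integral, of the Mellin transform of h at every
   z with Re z > s0: |x^(z-1)| = x^(Re z - 1). *)
Definition mellin_cvg (s0 : R) (h : R -> R) : Prop :=
  measurable_fun I01 h /\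
  forall s : R, s0 < s ->
    leb.-integrable I01 (fun x => (x `^ (s - 1) * h x)%:E).

Definition mellin_cvg_some (h : R -> R) : Prop :=
  exists s0 : R, mellin_cvg s0 h.

Definition is_kernel (K : xkernel) : Prop := mellin_cvg_some (kfun K).

(* x^(z-1) = x^(Re z - 1) (cos (Im z ln x) + i sin (Im z ln x)), integrated
   componentwise; delta(1 - x) has Mellin transform 1. *)
Definition mellin (K : xkernel) (z : R[i]) : R[i] :=
  let w x := x `^ (complex.Re z - 1) * kfun K x in
  Complex
    (\int[leb]_(x in I01) (w x * cos (complex.Im z * ln x)) + kdelta K)
    (\int[leb]_(x in I01) (w x * sin (complex.Im z * ln x))).

Definition conv (K : xkernel) (f : R -> R) (x : R) : R :=
  kdelta K * f x +
  \int[leb]_(xi in `]x, 1%R[) (xi^-1 * (kfun K xi * f (x / xi))).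

Definition ae01 (P : R -> Prop) : Prop :=
  {ae leb, forall x, 0 < x < 1 -> P x}.

(* A relation between kernels "at every x": it holds for the values of the
   function parts at almost every x and for the coefficients of delta(1 - x).
   The argument of P is the evaluation map on kernels. *)
Definition at_every_x (P : (xkernel -> R) -> Prop) : Prop :=
  ae01 (fun x => P (fun K => kfun K x)) /\ P kdelta.

End Kernels.

Arguments I01 R : clear implicits.

Section Flavor.
Variables (R : realType) (Nf : nat).
Let leb := @lebesgue_measure R.

Definition flavor := 'I_(Nf + Nf + 1).
Definition quark (i : 'I_Nf) : flavor := lshift 1 (lshift Nf i).
Definition antiquark (i : 'I_Nf) : flavor := lshift 1 (rshift Nf i).
Definition gluon : flavor := rshift (Nf + Nf) ord0.

Definition charge_conj_mx : 'M[R[i]]_(Nf + Nf + 1) :=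
  block_mx (block_mx 0 1%:M 1%:M 0) 0 0 1%:M.

Definition flavor_perm_mx (s : 'S_Nf) : 'M[R[i]]_(Nf + Nf + 1) :=
  block_mx (block_mx (perm_mx s) 0 0 (perm_mx s)) 0 0 1%:M.

Definition flavor_symmetric (A : 'M[R[i]]_(Nf + Nf + 1)) : Prop :=
  comm_mx A charge_conj_mx /\ forall s : 'S_Nf, comm_mx A (flavor_perm_mx s).

(* One function on (0, 1) per parton, each with a Mellin transform converging
   in some right half-plane, so that convolutions with kernels converge almost
   everywhere. *)
Definition densities (f : flavor -> R -> R) : Prop :=
  forall c, mellin_cvg_some (f c).

Definition nonneg_densities (f : flavor -> R -> R) : Prop :=
  densities f /\ forall c, ae01 (fun x => 0 <= f c x).

Definition Sigma_p (f : flavor -> R -> R) (x : R) : R :=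
  \sum_(i < Nf) (f (quark i) x + f (antiquark i) x).
Definition Sigma_m (f : flavor -> R -> R) (x : R) : R :=
  \sum_(i < Nf) (f (quark i) x - f (antiquark i) x).
Definition ns_p (i : 'I_Nf) (f : flavor -> R -> R) (x : R) : R :=
  f (quark i) x + f (antiquark i) x - Nf%:R^-1 * Sigma_p f x.
Definition ns_m (i : 'I_Nf) (f : flavor -> R -> R) (x : R) : R :=
  f (quark i) x - f (antiquark i) x - Nf%:R^-1 * Sigma_m f x.

Definition matrix_kernel := flavor -> flavor -> xkernel R.

Definition transform (k : matrix_kernel) (f : flavor -> R -> R) :
    flavor -> R -> R :=
  fun c x => \sum_(d : flavor) conv (k c d) (f d) x.

Definition mellin_mx (k : matrix_kernel) (z : R[i]) :
    'M[R[i]]_(Nf + Nf + 1) :=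
  \matrix_(c, d) mellin (k c d) z.

Definition mellin_col (f : flavor -> R -> R) (z : R[i]) :
    'cV[R[i]]_(Nf + Nf + 1) :=
  \col_c mellin (XKernel (f c) 0) z.

Record has_sector_kernels (k : matrix_kernel)
    (KSS KSg KgS Kgg Knsp Knsm KSm : xkernel R) : Prop := HasSectorKernels {
  sector_kernels : [/\ is_kernel KSS, is_kernel KSg, is_kernel KgS &
    is_kernel Kgg] /\ [/\ is_kernel Knsp, is_kernel Knsm & is_kernel KSm] ;
  sector_Sigma_p : forall f, densities f -> ae01 (fun x =>
    Sigma_p (transform k f) x = conv KSS (Sigma_p f) x + conv KSg (f gluon) x) ;
  sector_gluon : forall f, densities f -> ae01 (fun x =>
    transform k f gluon x = conv KgS (Sigma_p f) x + conv Kgg (f gluon) x) ;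
  sector_Sigma_m : forall f, densities f -> ae01 (fun x =>
    Sigma_m (transform k f) x = conv KSm (Sigma_m f) x) ;
  sector_ns_p : forall f, densities f -> forall i, ae01 (fun x =>
    ns_p i (transform k f) x = conv Knsp (ns_p i f) x) ;
  sector_ns_m : forall f, densities f -> forall i, ae01 (fun x =>
    ns_m i (transform k f) x = conv Knsm (ns_m i f) x) }.

Definition preserves_nonnegativity (k : matrix_kernel) : Prop :=
  forall f, nonneg_densities f -> nonneg_densities (transform k f).

Record sum_rules (n : 'I_Nf -> int) (f : flavor -> R -> R) : Prop := SumRules {
  momentum_integrable : forall c,
    leb.-integrable (I01 R) (fun x => (x * f c x)%:E) ;
  momentum_sum_rule :
    \sum_(c : flavor) \int[leb]_(x in I01 R) (x * f c x) = 1 ;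
  valence_integrable : forall i,
    leb.-integrable (I01 R)
      (fun x => (f (quark i) x - f (antiquark i) x)%:E) ;
  valence_sum_rule : forall i,
    \int[leb]_(x in I01 R) (f (quark i) x - f (antiquark i) x)
      = (n i)%:~R }.

(* F as a function of t = ln mu^2 *)
Definition in_lnmu2 (F : R -> R[i]) : R -> R[i] := fun t => F (expR (t / 2)).

Definition derivable_lnmu2 (F : R -> R[i]) (mu : R) : Prop :=
  derivable (fun t => complex.Re (in_lnmu2 F t)) (ln (mu ^+ 2)) 1 /\
  derivable (fun t => complex.Im (in_lnmu2 F t)) (ln (mu ^+ 2)) 1.

Definition d_lnmu2 (F : R -> R[i]) (mu : R) : R[i] :=
  Complex (derive1 (fun t => complex.Re (in_lnmu2 F t)) (ln (mu ^+ 2)))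
          (derive1 (fun t => complex.Im (in_lnmu2 F t)) (ln (mu ^+ 2))).

Definition derivable_lnmu2_mx p q (A : R -> 'M[R[i]]_(p, q)) (mu : R) : Prop :=
  forall c d, derivable_lnmu2 (fun m => A m c d) mu.

Definition d_lnmu2_mx p q (A : R -> 'M[R[i]]_(p, q)) (mu : R) :
    'M[R[i]]_(p, q) :=
  \matrix_(c, d) d_lnmu2 (fun m => A m c d) mu.

(* Throughout, scales range over mu > Lambda, and Mellin variables over the
   half-plane Re z > s0. *)

Definition is_coupling (Lambda : R) (a : R -> R) : Prop :=
  (forall mu, Lambda < mu -> 0 < a mu) /\ a mu @[mu --> +oo] --> (0 : R).

Record reference_dglap (Lambda s0 : R)
    (gamma : R -> R[i] -> 'M[R[i]]_(Nf + Nf + 1))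
    (fbar : R -> flavor -> R -> R) : Prop := ReferenceDGLAP {
  reference_cvg : forall mu c, Lambda < mu -> mellin_cvg s0 (fbar mu c) ;
  reference_derivable : forall mu z, Lambda < mu -> s0 < complex.Re z ->
    derivable_lnmu2_mx (fun m => mellin_col (fbar m) z) mu ;
  reference_evolution : forall mu z, Lambda < mu -> s0 < complex.Re z ->
    d_lnmu2_mx (fun m => mellin_col (fbar m) z) mu
      = gamma mu z *m mellin_col (fbar mu) z ;
  reference_symmetric : forall mu z, Lambda < mu -> s0 < complex.Re z ->
    flavor_symmetric (gamma mu z) }.

(* The last field is the asymptotic power series 1 + c_1 a + c_2 a^2 + ...
   in the coupling a(mu) as mu tends to infinity, at fixed z. *)
Record scheme_transformation (Lambda s0 : R) (a : R -> R)
    (k : R -> matrix_kernel) : Prop := SchemeTransformation {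
  scheme_cvg : forall mu c d, Lambda < mu -> mellin_cvg s0 (kfun (k mu c d)) ;
  scheme_invertible : forall mu z, Lambda < mu -> s0 < complex.Re z ->
    mellin_mx (k mu) z \in unitmx ;
  scheme_derivable : forall mu z, Lambda < mu -> s0 < complex.Re z ->
    derivable_lnmu2_mx (fun m => mellin_mx (k m) z) mu ;
  scheme_analytic : forall mu z c d, Lambda < mu -> s0 < complex.Re z ->
    derivable (fun w : R[i]^o => mellin_mx (k mu) w c d : R[i]^o) z 1 ;
  scheme_real : forall mu z, Lambda < mu -> s0 < complex.Re z ->
    mellin_mx (k mu) (conjc z) = map_mx (@conjc R) (mellin_mx (k mu) z) ;
  scheme_expansion : exists coef : nat -> R[i] -> 'M[R[i]]_(Nf + Nf + 1),
    forall z, s0 < complex.Re z ->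
      coef 0%N z = 1%:M /\
      forall m c d, exists M : R, \forall mu \near +oo,
        `| mellin_mx (k mu) z c d
           - \sum_(j < m.+1) (a mu ^+ j)%:C%C * coef j z c d |
        <= (M * a mu ^+ m.+1)%:C%C }.

Definition transformed_gamma (gamma : R -> R[i] -> 'M[R[i]]_(Nf + Nf + 1))
    (k : R -> matrix_kernel) (mu : R) (z : R[i]) :
    'M[R[i]]_(Nf + Nf + 1) :=
  mellin_mx (k mu) z *m gamma mu z *m invmx (mellin_mx (k mu) z)
  + d_lnmu2_mx (fun m => mellin_mx (k m) z) mu *m invmx (mellin_mx (k mu) z).

Record admissible (Lambda s0 : R) (a : R -> R)
    (gamma : R -> R[i] -> 'M[R[i]]_(Nf + Nf + 1)) (n : 'I_Nf -> int)
    (k : R -> matrix_kernel) : Prop := Admissible {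
  admissible_scheme : scheme_transformation Lambda s0 a k ;
  admissible_symmetric : forall mu z, Lambda < mu -> s0 < complex.Re z ->
    flavor_symmetric (transformed_gamma gamma k mu z) ;
  admissible_sum_rules : forall mu f, Lambda < mu -> densities f ->
    sum_rules n f -> sum_rules n (transform (k mu) f) }.

End Flavor.

(* Main.v *)
(** The sector relations diagonalise the flavor mixing. Undoing the
    diagonalisation, 2 Nf q_i' is the sum over partons d of K_d (x) f_d, where
    K_d is KSg for the gluon and otherwise
      Nf (Knsp + s Knsm) [i = j] + (KSS - Knsp) + s (KSm - Knsm),
    with s = 1 for a quark j and s = -1 for an antiquark j; the antiquark rows
    exchange the two signs. Since Nf > 1, both i = j and i <> j occur, and the
    stated inequalities say exactly that every entry of this mixing matrix is
    nonnegative. As the densities can be switched on one at a time, it remains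
    to see that a kernel K is nonnegative iff K (x) f >= 0 for all f >= 0. The
    test densities y^(-s) 1_(b,1)(y) turn the convolution into x^(-s) times
    delta 1_(b < x) + the integral of xi^(s-1) K(xi) over (x, x/b). For x > b
    and b -> 1 this gives the sign of the delta coefficient, and for x < b the
    sign of the function part by Lebesgue differentiation. *)
Require Import Defs.
From HB Require Import structures.
From mathcomp Require Import all_boot all_order all_algebra all_fingroup.
From mathcomp Require Import complex.
From mathcomp Require Import all_classical all_reals all_analysis.
From mathcomp Require Import measurable_realfun ring lra.
Import Order.TTheory GRing.Theory Num.Theory.
Import numFieldNormedType.Exports.
Local Open Scope ring_scope.
Local Open Scope classical_set_scope.

Set Implicit Arguments.
Unset Strict Implicit.
Unset Printing Implicit Defensive.

Section Convolution.
Variable R : realType.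
Local Notation leb := (@lebesgue_measure R).

(** * Multiplicative convolution on the real line *)

#[local] Instance ae_lebesgue_filter : Filter (nbhs (almost_everywhere leb)).
Proof. exact: ae_filter_ringOfSetsType. Qed.

(** Lebesgue measure agrees on half-open intervals with [c^-1] times its image under x -> x / c, so
    the two coincide by uniqueness. *)
Lemma integral_dilation (c : R) (F : R -> \bar R) : 0 < c ->
  measurable_fun setT F -> (forall x, 0 <= F x)%E ->
  (\int[leb]_x F (x / c)%R = c%:E * \int[leb]_x F x)%E.
Proof.
move=> c0 mF F0.
have ci0 : 0 <= c^-1 by rewrite invr_ge0 ltW.
pose phi (x : measurableTypeR R) : measurableTypeR R := x / c.
have mphi : measurable_fun setT phi by exact: mulrr_measurable.
pose m0 : {measure set (measurableTypeR R) -> \bar R} :=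
  measure_function_pushforward__canonical__measure_function_Measure leb mphi.
pose m := mscale (NngNum ci0) m0.
have mE (A : set R) : measurable A -> leb A = m A.
  apply: (@lebesgue_measure_unique R m) => _ [[a b]] _ <-.
  change (leb `]a, b] = (c^-1)%:E * leb (phi @^-1` `]a, b]))%E.
  rewrite (_ : phi @^-1` _ = `](a * c), (b * c)]%classic); last first.
    apply/seteqP; split=> x; rewrite /phi/= !in_itv/=;
      by rewrite ltr_pdivlMr// ler_pdivrMr.
  rewrite lebesgue_measure_itv/= lebesgue_measure_itv/= !lte_fin ltr_pM2r//.
  case: ifP => _; last by rewrite mule0.
  rewrite -!EFinB -EFinM; congr EFin.
  by field; rewrite gt_eqF.
rewrite [in RHS](@eq_measure_integral _ _ _ _ m); last first.
  by move=> A mA _; exact: mE.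
rewrite ge0_integral_mscale//= /m0 ge0_integral_pushforward//=.
by rewrite muleA -EFinM divff ?gt_eqF// mul1e.
Qed.


Lemma measurable_invr : measurable_fun setT (fun x : R => x^-1).
Proof.
(* Squaring makes the base of the power nonnegative, where exponent -1 is inversion; at 0 both sides
   are 0. *)
rewrite (_ : (fun x : R => x^-1) = (fun x => x * (x ^+ 2) `^ (-1))).
  apply: measurable_funM => //.
  apply: (measurableT_comp (f := fun y : R => y `^ (-1))).
    exact: measurable_powR.
  exact: exprn_measurable.
apply/funext => x; rewrite powR_inv1 ?sqr_ge0//.
by have [->|x0] := eqVneq x 0; [rewrite invr0 mul0r|field].
Qed.

(** [p] stands for (x, xi). No range is imposed on xi: after extension by zero from (0, 1), the
    supports of [H] and [F] cut it down to (x, 1). *)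
Definition mconv_integrand (H F : R -> R) (p : R * R) : R :=
  p.2^-1 * (H p.2 * F (p.1 / p.2)).

Lemma measurable_mconv_integrand (H F : R -> R) :
  measurable_fun setT H -> measurable_fun setT F ->
  measurable_fun setT (mconv_integrand H F).
Proof.
move=> mH mF.
have m2 (G : R -> R) : measurable_fun setT G ->
    measurable_fun setT (fun p : R * R => G p.2).
  by move=> mG; apply: measurableT_comp => //; exact: measurable_snd.
apply: measurable_funM; first by apply: m2; exact: measurable_invr.
apply: measurable_funM; first exact: m2.
apply: measurableT_comp => //; apply: measurable_funM => //.
by apply: m2; exact: measurable_invr.
Qed.

(** The dilation x -> x / xi produces a factor xi, which cancels the weight [xi^-1]. *)
Lemma integral_mconv_integrand1 (H F : R -> R) (xi : R) :
  0 < xi -> 0 <= H xi ->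
  measurable_fun setT F -> (forall x, 0 <= F x) ->
  (\int[leb]_x (mconv_integrand H F (x, xi))%:E
    = (H xi)%:E * \int[leb]_x (F x)%:E)%E.
Proof.
move=> xi0 h0 mF F0; rewrite /mconv_integrand/=.
have mF' : measurable_fun setT (fun x => (F x)%:E) by apply/measurable_EFinP.
under eq_integral do rewrite mulrA EFinM.
rewrite ge0_integralZl//=; last 3 first.
- apply/measurable_EFinP; apply: measurableT_comp => //.
  exact: mulrr_measurable.
- by move=> x _; rewrite lee_fin.
- by rewrite lee_fin mulr_ge0// invr_ge0 ltW.
rewrite (@integral_dilation _ (fun x => (F x)%:E))//.
by rewrite muleA -EFinM mulrAC mulVf ?mul1r// gt_eqF.
Qed.

(** Integrating the absolute value in x first gives |H xi| times the L1 norm of [F], so by Tonelli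
    the double integral is the product of two finite norms. *)
Lemma integrable_mconv_integrand (H F : R -> R) :
  (forall x, x <= 0 -> H x = 0) ->
  leb.-integrable setT (fun x => (H x)%:E) ->
  leb.-integrable setT (fun x => (F x)%:E) ->
  (leb \x leb)%E.-integrable setT (fun p => (mconv_integrand H F p)%:E).
Proof.
move=> H0 iH iF.
have mH : measurable_fun setT H by apply/measurable_EFinP; case/integrableP: iH.
have mF : measurable_fun setT F by apply/measurable_EFinP; case/integrableP: iF.
apply/integrable21ltyP.
  by apply/measurable_EFinP; exact: measurable_mconv_integrand.
have E xi : (\int[leb]_x `|(mconv_integrand H F (x, xi))%:E|
    = `|(H xi)%:E| * \int[leb]_x `|(F x)%:E|)%E.
  have [xi0|xi0] := ltP 0 xi.
    rewrite -(@integral_mconv_integrand1 (Num.norm \o H) (Num.norm \o F) xi)//=;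
      last first.
      exact: measurableT_comp.
    apply: eq_integral => x _; rewrite /mconv_integrand/= !normrM.
    by rewrite (@ger0_norm _ xi^-1)// invr_ge0 ltW.
  rewrite H0//= normr0 mul0e integral0_eq// => x _.
  by rewrite /mconv_integrand/= H0// mul0r mulr0 normr0.
under eq_integral do rewrite E.
rewrite ge0_integralZr//=; last 2 first.
- by apply/measurable_EFinP; exact: measurableT_comp.
- exact: integral_ge0.
case/integrableP: iH => _ iH; case/integrableP: iF => _ iF.
by rewrite lte_mul_pinfty// ?integral_ge0// ge0_fin_numE// integral_ge0.
Qed.

(** The exceptional null set of [F] is moved around by x / xi, so the sign cannot be read off at a
    fixed x. Instead the negative part [N] of the integrand has zero integral in x for almost every
    xi; Tonelli then makes its integral in xi vanish for almost every x. *)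
Lemma ae_mconv_integrand_ge0 (H F : R -> R) :
  (forall x, x <= 0 -> H x = 0) ->
  measurable_fun setT H -> measurable_fun setT F ->
  {ae leb, forall x, 0 <= H x} -> {ae leb, forall x, 0 <= F x} ->
  {ae leb, forall x, (0 <= \int[leb]_xi (mconv_integrand H F (x, xi))%:E)%E}.
Proof.
move=> H0 mH mF pH pF.
have mG := measurable_mconv_integrand mH mF.
pose N (p : R * R) : \bar R := ((fun p => (mconv_integrand H F p)%:E)^\- p)%E.
have mN : measurable_fun setT N.
  by apply: measurable_funeneg; apply/measurable_EFinP.
have N0 p : (0 <= N p)%E by exact: funeneg_ge0.
have F0 : (\int[leb]_x ((F^\- x)%R)%:E = 0)%E.
  rewrite (@ae_eq_integral _ _ _ _ _ (cst 0%E))//; first by rewrite integral0.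
  - by apply/measurable_EFinP; exact: measurable_funrneg.
  - move: pF; apply: filterS => x Fx _ /=; congr EFin.
    by rewrite /funrneg; apply/max_idPr; rewrite oppr_le0.
have NN : (\int[leb]_xi \int[leb]_x N (x, xi) = 0)%E.
  rewrite (@ae_eq_integral _ _ _ _ _ (cst 0%E))//; first by rewrite integral0.
  - exact: measurable_fun_fubini_tonelli_G.
  - move: pH; apply: filterS => xi Hxi _.
    have [xi0|xi0] := ltP 0 xi; last first.
      rewrite /= integral0_eq// => x _.
      by rewrite /N funenegE /mconv_integrand/= H0// mul0r mulr0 oppr0 maxxx.
    (* As [H xi] and [xi^-1] are nonnegative here, they come out of the maximum, and only the
       negative part of [F] remains inside. *)
    transitivity (\int[leb]_x (mconv_integrand H (F^\-)%R (x, xi))%:E)%E.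
      apply: eq_integral => x _.
      rewrite /N funenegE /mconv_integrand /funrneg/=.
      rewrite -EFin_max; congr EFin.
      have xiV0 : 0 <= xi^-1 by rewrite invr_ge0 ltW.
      by rewrite (maxr_pMr _ _ Hxi) (maxr_pMr _ _ xiV0) !mulr0 !mulrN.
    rewrite integral_mconv_integrand1// ?F0 ?mule0//.
    exact: measurable_funrneg.
have NN' : (\int[leb]_x \int[leb]_xi N (x, xi) = 0)%E.
  by rewrite -NN; exact: fubini_tonelli.
have mNx : measurable_fun setT (fun x => \int[leb]_xi N (x, xi))%E.
  exact: measurable_fun_fubini_tonelli_F.
have : (\int[leb]_x `| \int[leb]_xi N (x, xi) | = 0)%E.
  rewrite -[RHS]NN'; apply: eq_integral => x _.
  by rewrite gee0_abs// integral_ge0.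
move/(ae_eq_integral_abs leb measurableT mNx).1.
apply: filterS => x /(_ I)/= Nx.
rewrite integralE (_ : (\int[leb]_xi _^\- xi)%E = 0%E) ?sube0 ?integral_ge0//.
by rewrite -[RHS]Nx; apply: eq_integral => xi _; rewrite /N !funenegE.
Qed.

(** * Convolutions on (0, 1) and their Mellin convergence *)

Lemma I01E (x : R) : (x \in I01 R) = (0 < x < 1).
Proof. by apply/idP/idP; rewrite inE /I01/= in_itv/=. Qed.

(* The Lebesgue measure lives on [measurableTypeR R], whose display differs from
   the default one of [R]; hence the casts. *)
Lemma measurable_itvR (x y : R) :
  measurable (`]x, y[%classic : set (measurableTypeR R)).
Proof. exact: measurable_itv. Qed.

Lemma measurable_I01 : measurable (I01 R : set (measurableTypeR R)).
Proof. exact: measurable_itvR. Qed.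

Lemma restrict_I01_le0 (h : R -> R) :
  forall x : R, x <= 0 -> (h \_ (I01 R)) x = 0.
Proof. by move=> x x0; rewrite patchE I01E ltNge x0. Qed.

(** The support of [h] gives 0 < xi < 1, and that of [f] gives x / xi < 1, that is x < xi. *)
Lemma mconv_integrandE (h f : R -> R) (x : R) : 0 < x < 1 ->
  (fun xi => mconv_integrand (h \_ (I01 R)) (f \_ (I01 R)) (x, xi))
    = (fun xi => xi^-1 * (h xi * f (x / xi))) \_ `]x, 1%R[.
Proof.
move=> /andP[x0 x1]; apply/funext => xi.
rewrite /mconv_integrand/= !patchE !I01E.
have -> : (xi \in `]x, 1%R[) = (x < xi < 1).
  by apply/idP/idP; rewrite inE/= in_itv/=.
have [xi0|xi0] := leP xi 0.
  by rewrite (lt_gtF (le_lt_trans xi0 x0))/= mul0r mulr0.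
rewrite divr_gt0//= ltr_pdivrMr// mul1r.
by case: (xi < 1); case: (x < xi); rewrite /= ?mul0r ?mulr0 ?mul0r ?mulr0.
Qed.

(** The real integral in [conv] is manipulated linearly only at points where its integrand is
    integrable; this singles out those points. *)
Definition conv_cvg (K : xkernel R) (f : R -> R) (x : R) : Prop :=
  leb.-integrable `]x, 1%R[ (fun xi => (xi^-1 * (kfun K xi * f (x / xi)))%:E).

Lemma conv_cvgP (K : xkernel R) (f : R -> R) (x : R) : 0 < x < 1 ->
  conv_cvg K f x <-> leb.-integrable setT (fun xi =>
    (mconv_integrand (kfun K \_ (I01 R)) (f \_ (I01 R)) (x, xi))%:E).
Proof.
move=> x01; rewrite /conv_cvg integrable_mkcond//= restrict_EFin.
by rewrite -mconv_integrandE.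
Qed.

Lemma convE (K : xkernel R) (f : R -> R) (x : R) : 0 < x < 1 ->
  Defs.conv K f x = kdelta K * f x + \int[leb]_xi
    mconv_integrand (kfun K \_ (I01 R)) (f \_ (I01 R)) (x, xi).
Proof.
by move=> x01; rewrite /Defs.conv Rintegral_mkcond -mconv_integrandE.
Qed.

(* Twisting turns the Mellin weight x^(z-1) into an ordinary integrability
   condition and commutes with the convolution. *)
Definition twist (s : R) (h : R -> R) (x : R) : R := x `^ s * h x.

Lemma mconv_integrand_twist (s : R) (H F : R -> R) (x xi : R) :
  (forall x, x <= 0 -> H x = 0) -> 0 <= x ->
  mconv_integrand (twist s H) (twist s F) (x, xi)
    = x `^ s * mconv_integrand H F (x, xi).
Proof.
move=> H0 x0; rewrite /mconv_integrand /twist/=.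
have [xi0|xi0] := leP xi 0; first by rewrite H0// !(mulr0, mul0r).
have -> : x `^ s = xi `^ s * (x / xi) `^ s.
  rewrite -powRM ?(ltW xi0)// ?divr_ge0 ?(ltW xi0)//.
  by rewrite mulrCA divff ?mulr1// gt_eqF.
by ring.
Qed.

Lemma mellin_cvg_twist (s0 s : R) (h : R -> R) : mellin_cvg s0 h -> s0 < s ->
  leb.-integrable setT (fun x => (twist (s - 1) (h \_ (I01 R)) x)%:E).
Proof.
move=> [mh ih] /ih; rewrite integrable_mkcond//; last exact: measurable_I01.
rewrite restrict_EFin; congr (integrable _ _ _); apply/funext => x /=.
by congr EFin; rewrite /twist !patchE; case: ifP => //; rewrite mulr0.
Qed.

Lemma mellin_cvgW (s1 s0 : R) (h : R -> R) :
  s0 <= s1 -> mellin_cvg s0 h -> mellin_cvg s1 h.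
Proof. by move=> s01 [mh ih]; split=> // s /(le_lt_trans s01); exact: ih. Qed.

Lemma integrable_mconv_twist (s0 s : R) (h f : R -> R) :
  mellin_cvg s0 h -> mellin_cvg s0 f -> s0 < s ->
  (leb \x leb)%E.-integrable setT (fun p => (mconv_integrand
    (twist (s - 1) (h \_ (I01 R))) (twist (s - 1) (f \_ (I01 R))) p)%:E).
Proof.
move=> ch cf s0s; apply: integrable_mconv_integrand.
- by move=> x x0; rewrite /twist restrict_I01_le0// mulr0.
- exact: mellin_cvg_twist ch s0s.
- exact: mellin_cvg_twist cf s0s.
Qed.

(** Fubini makes the twisted integrand integrable in xi for almost every x. The twist is a nonzero
    factor depending on x alone, hence can be divided out. *)
Lemma conv_cvg_ae (K : xkernel R) (f : R -> R) :
  is_kernel K -> mellin_cvg_some f -> ae01 (conv_cvg K f).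
Proof.
move=> [sK cK] [sf cf]; pose s0 := Num.max sK sf.
have {}cK : mellin_cvg s0 (kfun K).
  by apply: mellin_cvgW cK; rewrite le_max lexx.
have {}cf : mellin_cvg s0 f by apply: mellin_cvgW cf; rewrite le_max lexx orbT.
have s1 : s0 < s0 + 1 by rewrite ltrDl.
have := ae_integrable1 (integrable_mconv_twist cK cf s1).
apply: filterS => x ix /[dup] x01 /andP[x0 x1]; apply/conv_cvgP => //.
pose c := (x `^ (s0 + 1 - 1))^-1.
have := integrableZl measurableT c ix; congr (integrable _ _ _).
apply/funext => xi/=; rewrite -EFinM; congr EFin.
rewrite mconv_integrand_twist ?ltW//; last exact: restrict_I01_le0.
by rewrite mulrA /c mulVf ?mul1r// gt_eqF// powR_gt0.
Qed.


(** The positive and negative parts of the integrand have measurable partial integrals by Tonelli,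
    and the integral is their difference. *)
Lemma measurable_conv (K : xkernel R) (f : R -> R) :
  measurable_fun (I01 R) (kfun K) -> measurable_fun (I01 R) f ->
  measurable_fun (I01 R) (Defs.conv K f).
Proof.
move=> mK mf.
apply: (eq_measurable_fun (fun x => kdelta K * f x + \int[leb]_xi
    mconv_integrand (kfun K \_ (I01 R)) (f \_ (I01 R)) (x, xi))).
  by move=> x; rewrite I01E => x01; rewrite convE.
apply: measurable_funD; first exact: measurable_funM.
apply: measurable_funTS.
apply: (measurableT_comp (f := @fine R)); first exact: fine_measurable.
pose G (p : R * R) := (mconv_integrand (kfun K \_ (I01 R)) (f \_ (I01 R)) p)%:E.
have mG : measurable_fun setT G.
  apply/measurable_EFinP; apply: measurable_mconv_integrand.
    by apply/(measurable_restrictT _ measurable_I01).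
  by apply/(measurable_restrictT _ measurable_I01).
rewrite (_ : (fun x => _) = (fun x =>
    \int[leb]_y (G^\+ (x, y)) - \int[leb]_y (G^\- (x, y)))%E).
  apply: emeasurable_funB.
    by apply: measurable_fun_fubini_tonelli_F => //; exact: measurable_funepos.
  by apply: measurable_fun_fubini_tonelli_F => //; exact: measurable_funeneg.
apply/funext => x; rewrite [LHS]integralE.
by congr (_ - _)%E; apply: eq_integral => y _; rewrite ?funeposE ?funenegE.
Qed.

Lemma mellin_cvg_conv (s0 : R) (K : xkernel R) (f : R -> R) :
  mellin_cvg s0 (kfun K) -> mellin_cvg s0 f -> mellin_cvg s0 (Defs.conv K f).
Proof.
move=> cK cf.
have mc := measurable_conv cK.1 cf.1.
split=> // s s0s.
have mw (h : R -> R) : measurable_fun (I01 R) h ->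
    measurable_fun (I01 R) (fun x => x `^ (s - 1) * h x).
  move=> mh; apply: measurable_funM => //; apply: measurable_funTS.
  exact: measurable_powR.
pose G p := (mconv_integrand (twist (s - 1) (kfun K \_ (I01 R)))
  (twist (s - 1) (f \_ (I01 R))) p)%:E.
have iG : (leb \x leb)%E.-integrable setT G := integrable_mconv_twist cK cf s0s.
(* [V] is the weighted convolution with its inner integral left extended-real. Fubini gives its
   integrability, and it agrees with the goal at almost every x, namely where the inner integrand is
   integrable. *)
pose V (x : R) : \bar R :=
  ((kdelta K * (x `^ (s - 1) * f x))%:E + \int[leb]_xi G (x, xi))%E.
have iV : leb.-integrable (I01 R) V.
  apply: (integrableD measurable_I01).
    have := integrableZl measurable_I01 (kdelta K) (cf.2 _ s0s).
    apply: eq_integrable; first exact: measurable_I01.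
    by move=> x _; rewrite EFinM.
  have := integrable_fubini_F iG.
  by apply: integrableS => //; exact: measurable_I01.
apply/integrableP; split; first by apply/measurable_EFinP; exact: mw.
case/integrableP: iV => mV; congr (_ < _)%E.
apply: ae_eq_integral.
- exact: measurable_I01.
- exact: measurableT_comp.
- by apply: measurableT_comp => //; apply/measurable_EFinP; exact: mw.
have := ae_integrable1 iG; apply: filterS => x ix.
move/mem_set; rewrite I01E => /[dup] x01 /andP[x0 x1]; congr (`|_|)%E.
have xs : x `^ (s - 1) != 0 by rewrite gt_eqF// powR_gt0.
have Gx : (fun xi => G (x, xi)) = (fun xi => (x `^ (s - 1))%:E *
    (mconv_integrand (kfun K \_ (I01 R)) (f \_ (I01 R)) (x, xi))%:E)%E.
  apply/funext => xi; rewrite /G mconv_integrand_twist ?ltW//.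
  exact: restrict_I01_le0.
have ix' : leb.-integrable setT (fun xi =>
    (mconv_integrand (kfun K \_ (I01 R)) (f \_ (I01 R)) (x, xi))%:E).
  have := integrableZl measurableT (x `^ (s - 1))^-1 ix.
  congr (integrable _ _ _).
  apply/funext => xi/=; rewrite /G mconv_integrand_twist ?ltW//; last first.
    exact: restrict_I01_le0.
  by rewrite -EFinM mulrA mulVf ?mul1r.
rewrite /V Gx convE// integralZl// mulrDr mulrCA EFinD; congr (_ + _)%E.
rewrite EFinM /Rintegral fineK//; exact: (integrable_fin_num measurableT ix').
Qed.

Lemma ae01_restrict (h : R -> R) (P : R -> Prop) : P 0 ->
  ae01 (fun x => P (h x)) -> {ae leb, forall x, P ((h \_ (I01 R)) x)}.
Proof.
move=> P0; rewrite /ae01; apply: filterS => x Px; rewrite patchE I01E.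
by case: ifP => // /Px.
Qed.

Lemma conv_ge0 (K : xkernel R) (f : R -> R) :
  measurable_fun (I01 R) (kfun K) -> measurable_fun (I01 R) f ->
  0 <= kdelta K -> ae01 (fun x => 0 <= kfun K x) -> ae01 (fun x => 0 <= f x) ->
  ae01 (fun x => 0 <= Defs.conv K f x).
Proof.
move=> mK mf d0 K0 f0.
have := @ae_mconv_integrand_ge0 (kfun K \_ (I01 R)) (f \_ (I01 R))
  (restrict_I01_le0 _) ((measurable_restrictT _ measurable_I01).1 mK)
  ((measurable_restrictT _ measurable_I01).1 mf)
  (ae01_restrict (P := fun y => 0 <= y) (lexx 0) K0)
  (ae01_restrict (P := fun y => 0 <= y) (lexx 0) f0).
move: f0; rewrite /ae01; apply: filterS2 => x fx ix x01.
rewrite convE// addr_ge0 ?mulr_ge0 ?fx//.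
(* [fine] sends an infinite integral to 0, so it preserves the sign in every case. *)
exact: fine_ge0.
Qed.

(** * Linearity of the convolution in the density and in the kernel *)

Lemma conv_cst0 (K : xkernel R) (x : R) : Defs.conv K (fun=> 0) x = 0.
Proof.
rewrite /Defs.conv mulr0 add0r (eq_Rintegral _ (g := cst 0)) => [|xi _].
  by rewrite Rintegral_cst//= mul0r.
by rewrite !mulr0.
Qed.

Lemma conv_cvg0 (K : xkernel R) (x : R) : conv_cvg K (fun=> 0) x.
Proof.
rewrite /conv_cvg (_ : (fun _ => _) = cst 0%E); first exact: integrable0.
by apply/funext => xi; rewrite !mulr0.
Qed.

Lemma conv_cvg_lin (K : xkernel R) (c : R) (f g : R -> R) (x : R) :
  conv_cvg K f x -> conv_cvg K g x -> conv_cvg K (fun y => c * f y + g y) x.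
Proof.
move=> cf cg.
have mI := measurable_itvR x 1.
have := integrableD mI (integrableZl mI c cf) cg.
congr (integrable _ _ _); apply/funext => xi /=.
by rewrite -EFinM -EFinD; congr EFin; ring.
Qed.

Lemma Rintegral_lin (D : set (measurableTypeR R)) (c : R) (u v : R -> R) :
  measurable D ->
  leb.-integrable D (EFin \o u) -> leb.-integrable D (EFin \o v) ->
  \int[leb]_(x in D) (c * u x + v x)
    = c * \int[leb]_(x in D) u x + \int[leb]_(x in D) v x.
Proof.
move=> mD iu iv; rewrite RintegralD//; first by rewrite RintegralZl.
by have := integrableZl mD c iu; congr (integrable _ _ _).
Qed.

Lemma conv_lin (K : xkernel R) (c : R) (f g : R -> R) (x : R) :
  conv_cvg K f x -> conv_cvg K g x ->
  Defs.conv K (fun y => c * f y + g y) x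
    = c * Defs.conv K f x + Defs.conv K g x.
Proof.
move=> cf cg; rewrite /Defs.conv [c * (_ + _)]mulrDr addrACA -Rintegral_lin//.
by congr (_ + _); [ring|apply: eq_Rintegral => xi _; ring].
Qed.

Lemma conv_cvg_sum (I : Type) (r : seq I) (K : xkernel R) (w : I -> R)
    (f : I -> R -> R) (x : R) : (forall i, conv_cvg K (f i) x) ->
  conv_cvg K (fun y => \sum_(i <- r) w i * f i y) x.
Proof.
move=> cf; elim: r => [|i r IH].
  by under eq_fun do rewrite big_nil; exact: conv_cvg0.
by under eq_fun do rewrite big_cons; exact: conv_cvg_lin.
Qed.

Lemma conv_sum (I : Type) (r : seq I) (K : xkernel R) (w : I -> R)
    (f : I -> R -> R) (x : R) : (forall i, conv_cvg K (f i) x) ->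
  Defs.conv K (fun y => \sum_(i <- r) w i * f i y) x
    = \sum_(i <- r) w i * Defs.conv K (f i) x.
Proof.
move=> cf; elim: r => [|i r IH].
  rewrite big_nil -[RHS](conv_cst0 K x); congr (Defs.conv _ _ _).
  by apply/funext => y; rewrite big_nil.
rewrite big_cons -IH -conv_lin//; last exact: conv_cvg_sum.
by congr (Defs.conv _ _ _); apply/funext => y; rewrite big_cons.
Qed.

Lemma mellin_cvg_some_lin (c : R) (h g : R -> R) :
  mellin_cvg_some h -> mellin_cvg_some g ->
  mellin_cvg_some (fun x => c * h x + g x).
Proof.
move=> [sh ch] [sg cg]; pose s0 := Num.max sh sg; exists s0.
have {}ch : mellin_cvg s0 h by apply: mellin_cvgW ch; rewrite le_max lexx.
have {}cg : mellin_cvg s0 g by apply: mellin_cvgW cg; rewrite le_max lexx orbT.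
split; first by apply: measurable_funD cg.1; exact: measurable_funM ch.1.
move=> s s0s.
have := integrableD measurable_I01
  (integrableZl measurable_I01 c (ch.2 _ s0s)) (cg.2 _ s0s).
congr (integrable _ _ _); apply/funext => x /=.
by rewrite -EFinM -EFinD; congr EFin; ring.
Qed.

Lemma mellin_cvg_some0 : mellin_cvg_some (fun=> 0 : R).
Proof.
exists 0; split => // s _; rewrite (_ : (fun _ => _) = cst 0%E).
  exact: integrable0.
by apply/funext => x; rewrite mulr0.
Qed.

Lemma mellin_cvg_some_sum (I : Type) (r : seq I) (f : I -> R -> R) :
  (forall i, mellin_cvg_some (f i)) ->
  mellin_cvg_some (fun x => \sum_(i <- r) f i x).
Proof.
move=> cf; elim: r => [|i r IH].
  by under eq_fun do rewrite big_nil; exact: mellin_cvg_some0.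
under eq_fun do rewrite big_cons -[X in X + _]mul1r.
exact: mellin_cvg_some_lin.
Qed.

Lemma mellin_cvg_some_conv (K : xkernel R) (f : R -> R) :
  is_kernel K -> mellin_cvg_some f -> mellin_cvg_some (Defs.conv K f).
Proof.
move=> [sK cK] [sf cf]; exists (Num.max sK sf); apply: mellin_cvg_conv.
  by apply: mellin_cvgW cK; rewrite le_max lexx.
by apply: mellin_cvgW cf; rewrite le_max lexx orbT.
Qed.

Definition klin (c : R) (K L : xkernel R) : xkernel R :=
  XKernel (fun x => c * kfun K x + kfun L x) (c * kdelta K + kdelta L).

Lemma is_kernel_klin (c : R) (K L : xkernel R) :
  is_kernel K -> is_kernel L -> is_kernel (klin c K L).
Proof. exact: mellin_cvg_some_lin. Qed.

Lemma conv_klin (c : R) (K L : xkernel R) (f : R -> R) (x : R) :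
  conv_cvg K f x -> conv_cvg L f x ->
  Defs.conv (klin c K L) f x = c * Defs.conv K f x + Defs.conv L f x.
Proof.
move=> cK cL; rewrite /Defs.conv [c * (_ + _)]mulrDr addrACA -Rintegral_lin//.
by congr (_ + _); [rewrite /=; ring|apply: eq_Rintegral => xi _ /=; ring].
Qed.

Lemma conv_cvg_klin (c : R) (K L : xkernel R) (f : R -> R) (x : R) :
  conv_cvg K f x -> conv_cvg L f x -> conv_cvg (klin c K L) f x.
Proof.
move=> cf cg.
have mI := measurable_itvR x 1.
have := integrableD mI (integrableZl mI c cf) cg.
congr (integrable _ _ _); apply/funext => xi /=.
by rewrite -EFinM -EFinD; congr EFin; ring.
Qed.

(** * Test densities and the sign of a kernel *)

Lemma mellin_cvg_indic_powR (s b : R) :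
  mellin_cvg (s + 1) (fun x => x `^ (- s) * ((b < x < 1)%R)%:R).
Proof.
have m1 : measurable_fun (I01 R) (fun x : R => ((b < x < 1)%R)%:R : R).
  rewrite (_ : (fun x => _) = \1_(`]b, 1[ : set R)).
    by apply: measurable_indic; exact: measurable_itv.
  by apply/funext => x; rewrite indicE mem_setE in_itv.
have mp (t : R) : measurable_fun (I01 R) (fun x : R => x `^ t).
  by apply: measurable_funTS; exact: measurable_powR.
have I1 : (leb (I01 R) < +oo)%E.
  by rewrite /I01 lebesgue_measure_itv/= lte01 -EFinB ltry.
split; first exact: measurable_funM.
move=> t st.
have mf : measurable_fun (I01 R)
    (fun x : R => x `^ (t - 1) * (x `^ (- s) * ((b < x < 1)%R)%:R)).
  by apply: measurable_funM => //; exact: measurable_funM.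
(* For t > s + 1 the exponent t - 1 - s is positive, so on (0, 1) the weighted function is bounded
   by 1. *)
apply: (@le_integrable _ _ _ leb _ measurable_I01 _ (EFin \o cst (1 : R))).
- exact/measurable_EFinP.
- move=> x; rewrite /I01/= in_itv/= => /andP[x0 x1].
  rewrite lee_fin normr1 mulrA -powRD; last by rewrite (gt_eqF x0) implybT.
  rewrite normrM ger0_norm ?powR_ge0//.
  rewrite (@le_trans _ _ (1 * `|((b < x < 1)%R)%:R|))//.
    rewrite ler_wpM2r// -[leRHS](powRr0 x) ger_powR ?x0 ?ltW//.
    by lra.
  by rewrite mul1r; case: (b < x < 1); rewrite ?normr1 ?normr0.
- apply: (@measurable_bounded_integrable _ _ _ leb) => //.
  + exact: measurable_I01.
  + by exists 1; split => // y y1 x _ /=; rewrite normr1 ltW.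
Qed.

(** The powers combine as xi^(-1) (x / xi)^(-s) = x^(-s) xi^(s - 1), and the condition b < x / xi <
    1 reads x < xi < x / b. *)
Lemma conv_indic_powR (K : xkernel R) (s0 s b x : R) :
  mellin_cvg s0 (kfun K) -> s0 < s -> 0 < b < 1 -> 0 < x < 1 ->
  Defs.conv K (fun y => y `^ (- s) * ((b < y < 1)%R)%:R) x
    = x `^ (- s) * (kdelta K * ((b < x)%R)%:R
        + \int[leb]_(xi in `]x, x / b[) twist (s - 1) (kfun K \_ (I01 R)) xi).
Proof.
move=> cK s0s /andP[b0 b1] /[dup] x01 /andP[x0 x1].
rewrite /Defs.conv mulrDr mulrCA; congr (_ + _); first by rewrite x1 andbT.
have mI := measurable_itvR x (x / b).
rewrite -RintegralZl//; last first.
  by apply: integrableS (mellin_cvg_twist cK s0s) => //; exact: measurableT.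
rewrite Rintegral_mkcond [RHS]Rintegral_mkcond; apply: eq_Rintegral => xi _.
rewrite !patchE !mem_setE !in_itv/= /twist patchE I01E.
case: (boolP (x < xi)) => //= xxi.
have xi0 : 0 < xi by rewrite (lt_trans x0).
have -> : (b < x / xi) = (xi < x / b) by rewrite !ltr_pdivlMr// mulrC.
have -> : x / xi < 1 by rewrite ltr_pdivrMr// mul1r.
rewrite xi0 andbT/=; case: (xi < 1); rewrite /= ?mulr0 ?if_same//.
case: ifP => _; rewrite ?mulr0// mulr1 !powRN.
have -> : x `^ s = xi `^ s * (x / xi) `^ s.
  rewrite -powRM ?(ltW xi0) ?divr_ge0 ?(ltW xi0) ?(ltW x0)//.
  by rewrite mulrCA divff ?mulr1// gt_eqF.
have -> : xi `^ (s - 1) = xi `^ s * xi^-1.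
  by rewrite powRD ?(gt_eqF xi0) ?implybT// powRN powRr1// ltW.
field; rewrite !gt_eqF ?powR_gt0 ?divr_gt0//.
Qed.

Lemma ae01_exists (b : R) (P : R -> Prop) : 0 <= b < 1 -> ae01 P ->
  exists x, b < x < 1 /\ P x.
Proof.
move=> /andP[b0 b1] aP; apply: contrapT => nP.
have nI : leb.-negligible `]b, 1%R[%classic.
  apply: negligibleS aP => x/=; rewrite in_itv/= => /andP[bx x1] Px.
  apply: nP; exists x; rewrite bx x1; split=> //; apply: Px.
  by rewrite x1 (le_lt_trans b0 bx).
have mI := measurable_itvR b 1.
have /eqP : leb `]b, 1%R[%classic = 0%E by exact: measure_negligible.
by rewrite lebesgue_measure_itv/= lte_fin b1 -EFinB eqe subr_eq0 gt_eqF.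
Qed.

(** Common starting point for the delta coefficient and the function part: the positive factor
    x^(-s) is removed, and one integrable weight serves for all b. *)
Lemma kernel_ge0_test (K : xkernel R) : is_kernel K ->
  (forall f, mellin_cvg_some f -> (forall x, 0 <= f x) ->
    ae01 (fun x => 0 <= Defs.conv K f x)) ->
  exists2 s : R,
    leb.-integrable setT (fun x => (twist (s - 1) (kfun K \_ (I01 R)) x)%:E) &
    forall b : R, 0 < b < 1 -> ae01 (fun x => 0 <= kdelta K * ((b < x)%R)%:R
      + \int[leb]_(xi in `]x, x / b[) twist (s - 1) (kfun K \_ (I01 R)) xi).
Proof.
move=> [s0 cK] Kf; have s0s : s0 < s0 + 1 by rewrite ltrDl.
exists (s0 + 1); first exact: mellin_cvg_twist cK s0s.
move=> b b01.
pose f (y : R) := y `^ (- (s0 + 1)) * ((b < y < 1)%R)%:R.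
have cf : mellin_cvg_some f.
  by exists (s0 + 1 + 1); exact: mellin_cvg_indic_powR.
have f0 x : 0 <= f x by rewrite mulr_ge0 ?powR_ge0.
have := Kf f cf f0; rewrite /ae01.
apply: filterS => x Px x01; move: (Px x01).
rewrite (conv_indic_powR cK)// pmulr_rge0// powR_gt0//.
by case/andP: x01.
Qed.

(** If the coefficient were negative, then for b close to 1 absolute continuity would make the
    integral over (x, x / b) too small to compensate it, against the test at some x in (b, 1). *)
Lemma kernel_delta_ge0 (K : xkernel R) : is_kernel K ->
  (forall f, mellin_cvg_some f -> (forall x, 0 <= f x) ->
    ae01 (fun x => 0 <= Defs.conv K f x)) ->
  0 <= kdelta K.
Proof.
move=> /kernel_ge0_test /[apply] -[s iw Kw]; rewrite leNgt; apply/negP => K0.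
have e0 : 0 < - kdelta K by rewrite oppr_gt0.
have [d [d0 wd]] := integral_normr_continuous iw e0.
(* With this [b] the interval from x to x / b has length x d / 2, which is below d when x < 1. *)
pose b := (1 + d / 2)^-1.
have d20 : 0 < d / 2 by rewrite divr_gt0.
have b0 : 0 < b by rewrite invr_gt0 addr_gt0.
have b1 : b < 1 by rewrite invf_lt1 ?addr_gt0// ltrDl.
have b01 : 0 < b < 1 by rewrite b0.
have b01' : 0 <= b < 1 by rewrite ltW.
have [x [/andP[bx x1]]] := ae01_exists b01' (Kw b b01).
have x0 : 0 < x := lt_trans b0 bx.
rewrite bx mulr1; apply/negP; rewrite -ltNge.
have mI := measurable_itvR x (x / b).
have xb : x / b - x = x * (d / 2) by rewrite /b invrK; ring.
have xxb : x < x / b by rewrite -subr_gt0 xb mulr_gt0.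
have mA : (leb `]x, (x / b)%R[%classic < d%:E)%E.
  rewrite lebesgue_measure_itv/= lte_fin xxb -EFinB lte_fin xb.
  by rewrite (@le_lt_trans _ _ (1 * (d / 2)))// ?ler_pM2r ?ltW//; lra.
rewrite -ltrBrDl sub0r (le_lt_trans (ler_norm _))//.
apply: le_lt_trans (wd _ mI mA).
by apply: le_normr_Rintegral => //; exact: integrableS iw.
Qed.

(** For x <= b the delta term is absent, so the mean of the twisted kernel over (x, x / b) is
    nonnegative. As b tends to 1, Lebesgue differentiation hands the sign to almost every x. *)
Lemma kernel_fun_ge0 (K : xkernel R) : is_kernel K ->
  (forall f, mellin_cvg_some f -> (forall x, 0 <= f x) ->
    ae01 (fun x => 0 <= Defs.conv K f x)) ->
  ae01 (fun x => 0 <= kfun K x).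
Proof.
move=> /kernel_ge0_test /[apply] -[s iw Kw].
set w := twist _ _ in iw Kw.
(* Chosen so that x / b n = x + x / (n + 1). *)
pose b (n : nat) : R := (1 + n.+1%:R^-1)^-1.
have n0 (n : nat) : 0 < n.+1%:R^-1 :> R by rewrite invr_gt0.
have b01 n : 0 < b n < 1.
  by rewrite invr_gt0 addr_gt0//= invf_lt1 ?addr_gt0// ltrDl.
(* The value 1 for x <= 0 keeps the intervals [E x n] nondegenerate at every real x; only x in (0,
   1) matters in the end. *)
pose c (x : R) : R := if 0 < x then x else 1.
have c0 x : 0 < c x by rewrite /c; case: ifP.
pose E (x : R) (n : nat) : set R := `]x, x + c x / n.+1%:R[%classic.
have ES x : nicely_shrinking x (E x).
  split; first by move=> n; exact: measurable_itv.
  pose r (n : nat) := PosNum (divr_gt0 (c0 x) (ltr0Sn R n)).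
  (* The one-sided interval fills half of the ball of the same radius, whence the constant 2. *)
  exists (2, r); split => //=.
  - rewrite -(mulr0 (c x)); apply: cvgM; [exact: cvg_cst|exact: cvg_harmonic].
  - move=> n y; rewrite /E/= in_itv/= -ball_normE/= => /andP[xy yx].
    by rewrite ltr0_norm ?subr_lt0// opprB ltrBlDl.
  - move=> n.
    have En : leb (E x n) = (c x / n.+1%:R)%:E.
      rewrite /E lebesgue_measure_itv/= lte_fin ltrDl divr_gt0// -EFinB.
      by rewrite addrAC subrr add0r.
    suff : (leb (ball x (c x / n.+1%:R)) <= 2%:E * leb (E x n))%E by [].
    rewrite lebesgue_measure_ball ?divr_ge0 ?(ltW (c0 x))//.
    by rewrite En -EFinM mulr_natl.
have lw : locally_integrable setT w.
  split; [|exact: openT|].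
    by apply/measurable_EFinP; exact: measurable_int iw.
  move=> A _ cA; case/integrableP: iw => mw; apply: le_lt_trans.
  apply: ge0_subset_integral => //; first exact: compact_measurable.
  apply/measurable_EFinP; apply: measurableT_comp => //.
  exact/measurable_EFinP.
have aw : {ae leb, forall x, lebesgue_pt w x} := lebesgue_differentiation lw.
(* Countably many values of b share a single null set. *)
have aKw : {ae leb, forall x, forall n, 0 < x < 1 ->
    0 <= kdelta K * ((b n < x)%R)%:R + \int[leb]_(xi in `]x, x / b n[) w xi}.
  by apply: ae_foralln => n; exact: Kw.
rewrite /ae01; move: aw aKw; apply: filterS2 => x wx Kx /[dup] x01 /andP[x0 x1].
suff : (0 <= (w x)%:E)%E.
  by rewrite lee_fin /w /twist patchE I01E x01 pmulr_rge0// powR_gt0.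
apply: cvge_to_ge (nice_lebesgue_differentiation ES lw wx) _.
(* Since x < 1 and [b n] tends to 1, the delta term eventually drops out. *)
have bx : \forall n \near \oo, x <= b n.
  have h : 0 < x^-1 - 1 by rewrite subr_gt0 invf_gt1.
  apply: filterS (near_infty_natSinv_lt (PosNum h)) => n /= hn.
  rewrite /b -[leLHS]invrK lef_pV2 ?posrE ?invr_gt0 ?addr_gt0//.
  by rewrite -lerBrDl ltW.
apply: filterS bx => n bx; apply: mule_ge0; first by rewrite inve_ge0.
have := Kx n x01; rewrite ltNge bx/= mulr0 add0r.
have -> : x / b n = x + c x / n.+1%:R by rewrite /b invrK /c x0; ring.
move=> w0; rewrite -(@fineK _ (\int[leb]_(y in E x n) (w y)%:E)) ?lee_fin//.
apply: integrable_fin_num; first exact: measurable_itv.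
by apply: integrableS iw => //; exact: measurable_itv.
Qed.

Lemma kernel_ge0P (K : xkernel R) : is_kernel K ->
  (forall f, mellin_cvg_some f -> ae01 (fun x => 0 <= f x) ->
    ae01 (fun x => 0 <= Defs.conv K f x))
  <-> at_every_x (fun v => 0 <= v K).
Proof.
move=> cK; split=> [Kf|[K0 d0] f cf f0].
  have Kf' f : mellin_cvg_some f -> (forall x, 0 <= f x) ->
      ae01 (fun x => 0 <= Defs.conv K f x).
    by move=> cf f0; apply: Kf => //; apply: aeW => x _.
  by split; [exact: kernel_fun_ge0|exact: kernel_delta_ge0].
by case: cK cf => sK [mK _] [sf [mf _]]; exact: conv_ge0.
Qed.

Lemma ae01W (P Q : R -> Prop) : (forall x, P x -> Q x) -> ae01 P -> ae01 Q.
Proof.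
by rewrite /ae01 => PQ; apply: filterS => x Px x01; apply: PQ; exact: Px.
Qed.

Lemma ae01I (P Q : R -> Prop) : ae01 P -> ae01 Q -> ae01 (fun x => P x /\ Q x).
Proof.
by rewrite /ae01; apply: filterS2 => x Px Qx x01; split; [exact: Px|exact: Qx].
Qed.

Lemma at_every_xI (P Q : (xkernel R -> R) -> Prop) :
  at_every_x P -> at_every_x Q -> at_every_x (fun v => P v /\ Q v).
Proof.
move=> [aP dP] [aQ dQ]; split => //.
exact: ae01I.
Qed.

(** * The flavor mixing matrix *)

Section Mixing.
Variable Nf : nat.
Hypothesis Nf_gt1 : (1 < Nf)%N.
Variables (KSS KSg KgS Kgg Kp Km KM : xkernel R).
Local Notation N := (Nf%:R : R).

(* The weight of (anti)quark [j] in [2 Nf] times the transform of (anti)quark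
   [i]: [b] is [i == j], and [e] is [1] if both are quarks or both antiquarks,
   [- 1] otherwise. *)
Definition pair_kernel (b : bool) (e : R) : xkernel R :=
  klin (N * b%:R) Kp (klin (e * (N * b%:R)) Km
    (klin (- 1) Kp (klin e KM (klin (- e) Km KSS)))).

Definition mixing_kernel (c d : flavor Nf) : xkernel R :=
  match fintype.split c, fintype.split d with
  | inl c', inl d' =>
    match fintype.split c', fintype.split d' with
    | inl i, inl j | inr i, inr j => pair_kernel (i == j) 1
    | inl i, inr j | inr i, inl j => pair_kernel (i == j) (- 1)
    end
  | inl _, inr _ => KSg
  | inr _, inl _ => KgS
  | inr _, inr _ => Kgg
  end.

(** The factor 2 Nf keeps the (anti)quark rows free of division; the gluon row is a sector relation
    already. *)
Definition mixing_weight (c : flavor Nf) : R :=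
  match fintype.split c with inl _ => 2 * N | inr _ => 1 end.

Lemma mixing_weight_gt0 c : 0 < mixing_weight c.
Proof.
rewrite /mixing_weight; case: (fintype.split c) => // _.
by rewrite mulr_gt0// ltr0n (ltn_trans _ Nf_gt1).
Qed.

Variant flavor_spec : flavor Nf -> Type :=
| FlavorQuark i : flavor_spec (quark i)
| FlavorAntiquark i : flavor_spec (antiquark i)
| FlavorGluon : flavor_spec (gluon Nf).

Lemma flavorP (c : flavor Nf) : flavor_spec c.
Proof.
case: (split_ordP c) => [c' ->|g ->]; last by rewrite ord1; exact: FlavorGluon.
case: (split_ordP c') => [i ->|i ->]; first exact: FlavorQuark.
exact: FlavorAntiquark.
Qed.

Lemma split_quark i : fintype.split (quark i : flavor Nf) = inl (lshift Nf i).
Proof. exact: (unsplitK (inl _)). Qed.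

Lemma split_antiquark i :
  fintype.split (antiquark i : flavor Nf) = inl (rshift Nf i).
Proof. exact: (unsplitK (inl _)). Qed.

Lemma split_gluon : fintype.split (gluon Nf) = inr ord0.
Proof. exact: (unsplitK (inr _)). Qed.

Lemma split_lshift m n (i : 'I_m) : fintype.split (lshift n i) = inl i.
Proof. exact: (unsplitK (inl _)). Qed.

Lemma split_rshift m n (i : 'I_n) : fintype.split (rshift m i) = inr i.
Proof. exact: (unsplitK (inr _)). Qed.

Definition splitE :=
  (split_quark, split_antiquark, split_gluon, split_lshift, split_rshift).

Lemma sum_flavor (F : flavor Nf -> R) :
  \sum_d F d = \sum_i F (quark i) + \sum_i F (antiquark i) + F (gluon Nf).
Proof. by rewrite !big_split_ord/= big_ord1. Qed.

Hypotheses (cKSS : is_kernel KSS) (cKSg : is_kernel KSg) (cKgS : is_kernel KgS)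
  (cKgg : is_kernel Kgg) (cKp : is_kernel Kp) (cKm : is_kernel Km)
  (cKM : is_kernel KM).

Lemma is_kernel_pair b e : is_kernel (pair_kernel b e).
Proof. by do !apply: is_kernel_klin. Qed.

Lemma is_kernel_mixing c d : is_kernel (mixing_kernel c d).
Proof.
have pk := is_kernel_pair.
by case: (flavorP c) => [i|i|]; case: (flavorP d) => [j|j|];
  rewrite /mixing_kernel !splitE.
Qed.

(** Off-diagonal quark entries, with e = 1 and e = -1, give the two sides of the absolute-value
    bound; diagonal ones give the two inequalities with Nf. *)
Lemma mixing_ge0P :
  (forall c d, at_every_x (fun v => 0 <= v (mixing_kernel c d))) <->
  at_every_x (fun v : xkernel R -> R =>
    [/\ 0 <= v KSg, 0 <= v KgS, 0 <= v Kgg &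
        `|v KM - v Km| <= v KSS - v Kp] /\
    (0 <= N * (v Kp + v Km) + (v KSS - v Kp) + (v KM - v Km)) /\
    (0 <= N * (v Kp - v Km) + (v KSS - v Kp) - (v KM - v Km))).
Proof.
split=> [E0|[E0 E1] c d].
  (* Two distinct flavors make off-diagonal entries available. Seven entries then represent all
     cases, gathered under one null set. *)
  pose i0 : 'I_Nf := Ordinal (ltnW Nf_gt1); pose i1 : 'I_Nf := Ordinal Nf_gt1.
  have := at_every_xI (at_every_xI (at_every_xI (E0 (quark i0) (quark i0))
    (E0 (quark i0) (antiquark i0))) (at_every_xI (E0 (quark i0) (quark i1))
    (E0 (quark i0) (antiquark i1)))) (at_every_xI (E0 (quark i0) (gluon Nf))
    (at_every_xI (E0 (gluon Nf) (quark i0)) (E0 (gluon Nf) (gluon Nf)))).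
  rewrite /mixing_kernel !splitE eqxx (_ : (i0 == i1) = false)//.
  case=> aE [[[d1 d2] [d3 d4]] [d5 [d6 d7]]]; split.
    move: aE; rewrite /ae01; apply: filterS => x xE x01.
    case: (xE x01) => [[[/= x1 x2] [x3 x4]] [x5 [x6 x7]]].
    by do !split => //; [rewrite ler_norml; apply/andP; split| |]; lra.
  move: d1 d2 d3 d4 => /= d1 d2 d3 d4.
  by do !split => //; [rewrite ler_norml; apply/andP; split| |]; lra.
split.
  move: E0; rewrite /ae01; apply: filterS => x xE x01; move: (xE x01).
  move=> [[x1 x2 x3]]; rewrite ler_norml => /andP[x4 x5] [x6 x7].
  case: (flavorP c) => [i|i|]; case: (flavorP d) => [j|j|];
    rewrite /mixing_kernel !splitE//=; case: (i == j) => /=; lra.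
case: E1 => [[x1 x2 x3]]; rewrite ler_norml => /andP[x4 x5] [x6 x7].
case: (flavorP c) => [i|i|]; case: (flavorP d) => [j|j|];
  rewrite /mixing_kernel !splitE//=; case: (i == j) => /=; lra.
Qed.

Lemma conv_pair_kernel b e (f : R -> R) x :
  conv_cvg KSS f x -> conv_cvg Kp f x -> conv_cvg Km f x -> conv_cvg KM f x ->
  Defs.conv (pair_kernel b e) f x
    = N * b%:R * Defs.conv Kp f x + (e * (N * b%:R) * Defs.conv Km f x
      + (- 1 * Defs.conv Kp f x + (e * Defs.conv KM f x
      + (- e * Defs.conv Km f x + Defs.conv KSS f x)))).
Proof.
move=> cS cp cm cM.
by do 5 (rewrite conv_klin; [|by []|by do ?apply: conv_cvg_klin]).
Qed.

Lemma sum_diag (i : 'I_Nf) (c : R) (F : 'I_Nf -> R) :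
  \sum_j c * (i == j)%:R * F j = c * F i.
Proof.
rewrite (bigD1 i)//= eqxx mulr1 big1 ?addr0// => j /negPf.
by rewrite eq_sym => ->; rewrite mulr0 mul0r.
Qed.

Lemma sum_pair_coef (i : 'I_Nf) (e : R) (p m M S : 'I_Nf -> R) :
  \sum_j (N * (i == j)%:R * p j + (e * (N * (i == j)%:R) * m j
    + (- 1 * p j + (e * M j + (- e * m j + S j)))))
  = N * p i + (e * N * m i + (- \sum_j p j + (e * \sum_j M j
    + (- e * \sum_j m j + \sum_j S j)))).
Proof.
under eq_bigr do rewrite (mulrA e).
by rewrite !big_split/= !sum_diag -!mulr_sumr mulN1r.
Qed.

Lemma sum_conv_pair_kernel (i : 'I_Nf) (e : R) (f : 'I_Nf -> R -> R) x :
  (forall j, [/\ conv_cvg KSS (f j) x, conv_cvg Kp (f j) x,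
    conv_cvg Km (f j) x & conv_cvg KM (f j) x]) ->
  \sum_j Defs.conv (pair_kernel (i == j) e) (f j) x
    = N * Defs.conv Kp (f i) x + (e * N * Defs.conv Km (f i) x
      + (- \sum_j Defs.conv Kp (f j) x + (e * \sum_j Defs.conv KM (f j) x
      + (- e * \sum_j Defs.conv Km (f j) x + \sum_j Defs.conv KSS (f j) x)))).
Proof.
move=> cf; rewrite -sum_pair_coef; apply: eq_bigr => j _.
by case: (cf j) => *; rewrite conv_pair_kernel.
Qed.

(** Taking e = 1 or e = -1 treats both charge parities at once. *)
Definition Sigma_e (e : R) (f : flavor Nf -> R -> R) (x : R) : R :=
  \sum_(i < Nf) (f (quark i) x + e * f (antiquark i) x).

Lemma Sigma_pE f : Sigma_p f = Sigma_e 1 f.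
Proof. by apply/funext => x; apply: eq_bigr => i _; rewrite mul1r. Qed.

Lemma Sigma_mE f : Sigma_m f = Sigma_e (- 1) f.
Proof. by apply/funext => x; apply: eq_bigr => i _; rewrite mulN1r. Qed.

Lemma conv_Sigma (K : xkernel R) (e : R) f x : (forall d, conv_cvg K (f d) x) ->
  conv_cvg K (Sigma_e e f) x /\ Defs.conv K (Sigma_e e f) x
    = \sum_i Defs.conv K (f (quark i)) x
      + e * \sum_i Defs.conv K (f (antiquark i)) x.
Proof.
move=> cf.
have -> : Sigma_e e f =
    fun y => \sum_(i < Nf) 1 * (e * f (antiquark i) y + f (quark i) y).
  by apply/funext => y; apply: eq_bigr => i _; rewrite mul1r addrC.
have cg i : conv_cvg K (fun y => e * f (antiquark i) y + f (quark i) y) x.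
  exact: conv_cvg_lin.
split; first exact: conv_cvg_sum.
rewrite conv_sum// mulr_sumr -big_split/=; apply: eq_bigr => i _.
by rewrite conv_lin// mul1r addrC.
Qed.

Lemma conv_ns (K : xkernel R) (e : R) f x i : (forall d, conv_cvg K (f d) x) ->
  Defs.conv K (fun y => f (quark i) y + e * f (antiquark i) y
      - N^-1 * Sigma_e e f y) x
    = Defs.conv K (f (quark i)) x + e * Defs.conv K (f (antiquark i)) x
      - N^-1 * Defs.conv K (Sigma_e e f) x.
Proof.
move=> cf; have [cS _] := conv_Sigma e cf.
transitivity (Defs.conv K (fun y => - N^-1 * Sigma_e e f y
    + (e * f (antiquark i) y + f (quark i) y)) x).
  by congr (Defs.conv _ _ _); apply/funext => y; ring.
rewrite conv_lin//; last exact: conv_cvg_lin.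
by rewrite conv_lin//; ring.
Qed.

(** Multiplying the non-singlet terms by Nf turns their subtracted averages into full singlet sums,
    which account for the - [Kp] and - s [Km] contributions to every pair kernel. *)
Lemma sum_mixing_quark (i : 'I_Nf) (f : flavor Nf -> R -> R) (s x : R) :
  (forall d, [/\ conv_cvg KSS (f d) x, conv_cvg Kp (f d) x,
    conv_cvg Km (f d) x & conv_cvg KM (f d) x]) ->
  \sum_j Defs.conv (pair_kernel (i == j) s) (f (quark j)) x
    + \sum_j Defs.conv (pair_kernel (i == j) (- s)) (f (antiquark j)) x
  = N * (Defs.conv Kp (ns_p i f) x + s * Defs.conv Km (ns_m i f) x)
    + (Defs.conv KSS (Sigma_p f) x + s * Defs.conv KM (Sigma_m f) x).
Proof.
move=> cf.
have N0 : N != 0 by rewrite pnatr_eq0 -lt0n (ltn_trans _ Nf_gt1).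
have cS d : conv_cvg KSS (f d) x by case: (cf d).
have cp d : conv_cvg Kp (f d) x by case: (cf d).
have cm d : conv_cvg Km (f d) x by case: (cf d).
have cM d : conv_cvg KM (f d) x by case: (cf d).
have -> : ns_p i f = fun y => f (quark i) y + 1 * f (antiquark i) y
    - N^-1 * Sigma_e 1 f y.
  by apply/funext => y; rewrite /ns_p Sigma_pE mul1r.
have -> : ns_m i f = fun y => f (quark i) y + - 1 * f (antiquark i) y
    - N^-1 * Sigma_e (- 1) f y.
  by apply/funext => y; rewrite /ns_m Sigma_mE mulN1r.
rewrite !conv_ns// Sigma_pE Sigma_mE.
rewrite (conv_Sigma 1 cS).2 (conv_Sigma 1 cp).2.
rewrite (conv_Sigma (- 1) cm).2 (conv_Sigma (- 1) cM).2.
rewrite !sum_conv_pair_kernel//.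
by field.
Qed.

(** * From the sector relations to individual partons *)

Variable k : matrix_kernel R Nf.
Hypothesis hK : has_sector_kernels k KSS KSg KgS Kgg Kp Km KM.

(** The sectors recombine through Nf ([ns_p] + s [ns_m]) + [Sigma_p] + s [Sigma_m], which is 2 Nf
    times the quark for s = 1 and the antiquark for s = -1. *)
Lemma transform_mixing (f : flavor Nf -> R -> R) (c : flavor Nf) :
  densities f ->
  ae01 (fun x => mixing_weight c * transform k f c x
    = \sum_d Defs.conv (mixing_kernel c d) (f d) x).
Proof.
move=> df.
have N0 : N != 0 by rewrite pnatr_eq0 -lt0n (ltn_trans _ Nf_gt1).
have cvg K : is_kernel K -> ae01 (fun x => forall d, conv_cvg K (f d) x).
  move=> cK.
  (* There are finitely many partons, so one null set serves them all. *)
  have : {ae leb, forall x, forall d, 0 < x < 1 -> conv_cvg K (f d) x}.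
    by apply: filter_forall => d; exact: conv_cvg_ae.
  by rewrite /ae01; apply: filterS => x Px x01 d; exact: Px.
have quark_row (i : 'I_Nf) (s : R) : ae01 (fun x =>
    N * (ns_p i (transform k f) x + s * ns_m i (transform k f) x)
      + (Sigma_p (transform k f) x + s * Sigma_m (transform k f) x)
    = \sum_j Defs.conv (pair_kernel (i == j) s) (f (quark j)) x
      + \sum_j Defs.conv (pair_kernel (i == j) (- s)) (f (antiquark j)) x
      + Defs.conv KSg (f (gluon Nf)) x).
  have h := ae01I (ae01I (cvg _ cKSS) (cvg _ cKp))
    (ae01I (cvg _ cKm) (cvg _ cKM)).
  have g := ae01I (ae01I (sector_Sigma_p hK df) (sector_Sigma_m hK df))
    (ae01I (sector_ns_p hK df i) (sector_ns_m hK df i)).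
  apply: ae01W (ae01I h g) => x [[[cS cp] [cm cM]] [[eS eM] [ep em]]].
  rewrite eS eM ep em sum_mixing_quark; last by move=> d; split.
  by ring.
case: (flavorP c) => [i|i|].
- apply: ae01W (quark_row i 1) => x Hx.
  rewrite sum_flavor /mixing_weight /mixing_kernel splitE.
  transitivity (\sum_j Defs.conv (pair_kernel (i == j) 1) (f (quark j)) x
      + \sum_j Defs.conv (pair_kernel (i == j) (- 1)) (f (antiquark j)) x
      + Defs.conv KSg (f (gluon Nf)) x).
    by rewrite -Hx /ns_p /ns_m; field.
  by congr (_ + _ + _); [apply: eq_bigr => j _..|]; rewrite ?splitE.
- apply: ae01W (quark_row i (- 1)) => x Hx.
  rewrite sum_flavor /mixing_weight /mixing_kernel splitE.
  transitivity (\sum_j Defs.conv (pair_kernel (i == j) (- 1)) (f (quark j)) x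
      + \sum_j Defs.conv (pair_kernel (i == j) 1) (f (antiquark j)) x
      + Defs.conv KSg (f (gluon Nf)) x).
    by move: Hx; rewrite opprK => <-; rewrite /ns_p /ns_m; field.
  by congr (_ + _ + _); [apply: eq_bigr => j _..|]; rewrite ?splitE.
- apply: ae01W (ae01I (cvg _ cKgS) (sector_gluon hK df)) => x [cS ->].
  rewrite sum_flavor /mixing_weight /mixing_kernel splitE mul1r Sigma_pE.
  rewrite (conv_Sigma 1 cS).2 mul1r.
  by congr (_ + _ + _); apply: eq_bigr => j _; rewrite splitE.
Qed.

Lemma mixing_ge0_of_preserves : preserves_nonnegativity k ->
  forall c d, at_every_x (fun v => 0 <= v (mixing_kernel c d)).
Proof.
move=> pk c d; apply/kernel_ge0P; first exact: is_kernel_mixing.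
move=> phi cphi phi0.
(* A single density switched on isolates column [d] of the mixing matrix. *)
pose f (d' : flavor Nf) : R -> R := if d' == d then phi else fun=> 0.
have df : densities f.
  by move=> d'; rewrite /f; case: ifP => // _; exact: mellin_cvg_some0.
have f0 d' : ae01 (fun x => 0 <= f d' x).
  by rewrite /f; case: ifP => // _; apply: aeW.
have [_ /(_ c) tf0] := pk f (conj df f0).
apply: ae01W (ae01I tf0 (transform_mixing c df)) => x [t0 tE].
suff -> : Defs.conv (mixing_kernel c d) phi x
    = mixing_weight c * transform k f c x.
  by rewrite mulr_ge0// ltW// mixing_weight_gt0.
rewrite tE (bigD1 d)//= big1 => [|d' /negPf dd'].
  by rewrite addr0 /f eqxx.
by rewrite /f dd' conv_cst0.
Qed.

(** Mellin convergence of the output comes from the kernels of [k] themselves, its sign from the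
    mixing matrix. *)
Lemma preserves_of_mixing_ge0 : (forall c d, is_kernel (k c d)) ->
  (forall c d, at_every_x (fun v => 0 <= v (mixing_kernel c d))) ->
  preserves_nonnegativity k.
Proof.
move=> ck E0 f [df f0]; split.
  move=> c; apply: mellin_cvg_some_sum => d; exact: mellin_cvg_some_conv.
move=> c.
have Ef0 : {ae leb, forall x, forall d, 0 < x < 1 ->
    0 <= Defs.conv (mixing_kernel c d) (f d) x}.
  apply: filter_forall => d.
  by have /kernel_ge0P := E0 c d; apply => //; exact: is_kernel_mixing.
have Ef0' : ae01 (fun x =>
    forall d, 0 <= Defs.conv (mixing_kernel c d) (f d) x).
  by move: Ef0; rewrite /ae01; apply: filterS => x Px x01 d; exact: Px.
apply: ae01W (ae01I Ef0' (transform_mixing c df)) => x [x0 tE].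
by rewrite -(pmulr_rge0 _ (mixing_weight_gt0 c)) tE sumr_ge0.
Qed.
End Mixing.

End Convolution.

Unset Implicit Arguments.
Local Close Scope classical_set_scope.

Theorem theorem3 (R : realType) (Nf : nat) (hNf : (1 < Nf)%N)
  (n : 'I_Nf -> int) (Lambda s0 : R) (hLambda : 0 <= Lambda)
  (a : R -> R) (ha : is_coupling Lambda a)
  (gamma : R -> R[i] -> 'M[R[i]]_(Nf + Nf + 1))
  (fbar : R -> flavor Nf -> R -> R)
  (hgamma : reference_dglap Lambda s0 gamma fbar)
  (k : R -> matrix_kernel R Nf)
  (hk : admissible Lambda s0 a gamma n k)
  (mu : R) (hmu : Lambda < mu)
  (KSS KSg KgS Kgg Knsp Knsm KSm : xkernel R)
  (hK : has_sector_kernels (k mu) KSS KSg KgS Kgg Knsp Knsm KSm) :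
  preserves_nonnegativity (k mu) <->
  at_every_x (fun v : xkernel R -> R =>
    [/\ 0 <= v KSg, 0 <= v KgS, 0 <= v Kgg &
        `|v KSm - v Knsm| <= v KSS - v Knsp] /\
    (0 <= Nf%:R * (v Knsp + v Knsm) + (v KSS - v Knsp) + (v KSm - v Knsm)) /\
    (0 <= Nf%:R * (v Knsp - v Knsm) + (v KSS - v Knsp) - (v KSm - v Knsm))).
Proof.
have [[cSS cSg cgS cgg] [cp cm cM]] := sector_kernels hK.
have ck c d : is_kernel (k mu c d).
  by exists s0; exact: (scheme_cvg (admissible_scheme hk)).
apply: iff_trans (mixing_ge0P hNf KSS KSg KgS Kgg Knsp Knsm KSm).
split; last exact: preserves_of_mixing_ge0 hK ck.
exact: mixing_ge0_of_preserves hK.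
Qed.
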